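(* For any size $n\ge1$ of the problem, there exists a unique optimal number $p^*=p^*(n)>0$ of processors minimizing $N(p)$ over $p\in(0,\infty)$. Moreover, when $n\to+\infty$, $$p^*\approx\left(\frac34\right)^{1/3}n^{2/3},$$ $$N(p^* )\approx\left(\left(\frac43\right)^{1/3}+\frac23\left(\frac34\right)^{2/3}\right)n^{2+1/3}\approx 1.651\,n^{2+1/3},$$ where the first $\approx$ in each line means that the ratio of the two sides tends to $1$ as $n\to+\infty$ (and $1.651$ is a numerical approximation of the constant).
   Context: For a linear system of size $n$ and $p$ processors, $N(p)$ denotes the worst-case number of scalar multiplications carried out by each processor in the multithread cooperative Conjugate Gradient method with $p$ agents in exact arithmetic, given by $$N(p)=\frac{n^3}{p}+6n^2+n\,\frac{(p+1)(2p+1)}{3}.$$ The variable $p$ is treated as a positive real variable in this optimization. *)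

(* Defs.v *)
From Stdlib Require Import Reals.
From Coquelicot Require Import Coquelicot.
Open Scope R_scope.

(* Worst-case number of scalar multiplications per processor for a system of
   size [n]; the number [p] of processors is relaxed to a real, and the formula
   is meaningful only for [p > 0]. *)
Definition mult_count (n : nat) (p : R) : R :=
  INR n ^ 3 / p + 6 * INR n ^ 2 + INR n * ((p + 1) * (2 * p + 1) / 3).

Definition optimal_processors (n : nat) (p : R) : Prop :=
  0 < p /\ forall q : R, 0 < q -> mult_count n p <= mult_count n q.

Definition asymp_equiv (u v : nat -> R) : Prop :=
  is_lim_seq (fun n => u n / v n) 1.

Definition optimal_cost_constant : R :=
  Rpower (4 / 3) (1 / 3) + 2 / 3 * Rpower (3 / 4) (2 / 3).

(* Main.v *)
Require Import Defs.
From Stdlib Require Import Reals Lra Psatz.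
From Coquelicot Require Import Coquelicot.
Open Scope R_scope.

(** Dividing [mult_count n p] by [n] and differentiating, the critical points
    are the positive roots of the cubic [4 p^3 + 3 p^2 = 3 n^2], whose left
    side increases from [0] to infinity. Subtracting the value at a root [c]
    gives the exact identity
    [N(q) - N(c) = n (q - c)^2 (2 q + 4 c + 3) / (3 q)]
    ([mult_count_excess]), so [c] is the strict global minimizer: existence,
    uniqueness and the characterization of optimal [p] by the cubic
    ([optimal_processors_iff]) all follow without any calculus beyond the
    intermediate value theorem.

    For the asymptotics put [k = (3/4)^(1/3)], [t = n^(1/3)] and [a = k t^2],
    the predicted value of [p]. Since [a^3 = (3/4) n^2], the ratio [r = p / a]
    satisfies [r^3 + (3/4) r^2 / a = 1]; this confines it to
    [1 - 3 / (4 a) <= r <= 1], and [a] tends to infinity. As [1 / k] equals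
    [(4/3) k^2], the constant of the theorem is [2 k^2], so that the predicted
    cost is [2 n a^2], and
    [N(p) / (2 n a^2) = (2/3) / r + 3 n / a^2 + r^2 / 3 + r / (2 a) + 1 / (6 a^2)].
    Here [n / a^2 = 1 / (k^2 t)] tends to [0], and the right side tends to
    [2/3 + 1/3 = 1]. The numerical value comes from bracketing [k] between two
    decimals whose cubes bracket [3/4]. *)

(** * The unique minimizer *)

(** The difference of the two costs is divisible by [q - c], and the criticality
    of [c] makes the cofactor vanish at [q = c] as well. *)
Lemma mult_count_excess (n : nat) (c q : R) :
  0 < c -> 0 < q -> 4 * c ^ 3 + 3 * c ^ 2 = 3 * INR n ^ 2 ->
  mult_count n q - mult_count n c =
  INR n * ((q - c) ^ 2 * (2 * q + 4 * c + 3) / (3 * q)).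
Proof.
intros Hc Hq Hn; unfold mult_count.
(* Isolating [n^2] lets [field] see the hypothesis. *)
replace (INR n ^ 3) with (INR n * (c ^ 2 * (4 * c + 3) / 3)).
- field; lra.
- replace (INR n ^ 3) with (INR n * INR n ^ 2) by ring.
  replace (INR n ^ 2) with ((4 * c ^ 3 + 3 * c ^ 2) / 3) by lra.
  field.
Qed.

Lemma critical_point_exists (x : R) :
  1 <= x -> exists c, 0 < c /\ 4 * c ^ 3 + 3 * c ^ 2 = 3 * x ^ 2.
Proof.
intros Hx.
destruct (IVT (fun c => 4 * c ^ 3 + 3 * c ^ 2 - 3 * x ^ 2) 0 x)
  as [c [[Hc0 Hcx] Hc]].
- reg.
- lra.
- nra.
- assert (0 < x ^ 3) by (apply pow_lt; lra); lra.
- exists c; split; [| lra].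
  destruct (Req_dec c 0) as [-> | Hne]; [nra | lra].
Qed.

(** Comparing an optimal [p] with the root [c] of the cubic leaves no room for
    the nonnegative excess, which forces [p = c]. *)
Lemma optimal_processors_iff (n : nat) (p : R) :
  (1 <= n)%nat ->
  optimal_processors n p <-> 0 < p /\ 4 * p ^ 3 + 3 * p ^ 2 = 3 * INR n ^ 2.
Proof.
intros Hn; apply le_INR in Hn; simpl in Hn; split.
- intros [Hp Hmin].
  destruct (critical_point_exists (INR n) Hn) as [c [Hc Ec]].
  assert (Epc : p = c).
  { generalize (mult_count_excess n c p Hc Hp Ec) (Hmin c Hc); intros E Hle.
    destruct (Req_dec p c) as [| Hne]; [assumption |].
    assert (0 < (p - c) ^ 2) by (apply pow2_gt_0; lra).
    assert (0 < INR n * ((p - c) ^ 2 * (2 * p + 4 * c + 3) / (3 * p))).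
    { apply Rmult_lt_0_compat; [lra |].
      apply Rdiv_lt_0_compat; [apply Rmult_lt_0_compat |]; lra. }
    lra. }
  subst c; now split.
- intros [Hp Ep]; split; [assumption | intros q Hq].
  generalize (mult_count_excess n p q Hp Hq Ep); intros E.
  assert (0 <= INR n * ((q - p) ^ 2 * (2 * q + 4 * p + 3) / (3 * q))).
  { apply Rmult_le_pos; [lra |].
    apply Rdiv_le_0_compat; [apply Rmult_le_pos; [apply pow2_ge_0 |] |]; lra. }
  lra.
Qed.

(** Uniqueness holds because the left side of the cubic is strictly increasing
    on the positive reals: the difference of two of its values is [q - c] times
    a positive factor. *)
Lemma optimal_processors_unique (n : nat) :
  (1 <= n)%nat -> exists! p : R, optimal_processors n p.
Proof.
intros Hn.
assert (Hn1 : 1 <= INR n) by (apply le_INR in Hn; exact Hn).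
destruct (critical_point_exists (INR n) Hn1) as [c [Hc Ec]].
exists c; split; [now apply optimal_processors_iff |].
intros q Hq; apply optimal_processors_iff in Hq; [| assumption].
destruct Hq as [Hq Eq].
assert (E : (q - c) * (4 * (q ^ 2 + q * c + c ^ 2) + 3 * (q + c)) = 0)
  by (ring_simplify; lra).
apply Rmult_integral in E as [E | E]; [lra | nra].
Qed.

(** * Powers of three quarters *)

Lemma Rpower_INR_mult (x y : R) (m : nat) :
  Rpower x (INR m * y) = Rpower x y ^ m.
Proof.
rewrite <- Rpower_pow, Rpower_mult by apply exp_pos.
f_equal; ring.
Qed.

Lemma Rpower_third_pow3 (x : R) : 0 < x -> Rpower x (1 / 3) ^ 3 = x.
Proof.
intros Hx; rewrite <- Rpower_INR_mult.
replace (INR 3 * (1 / 3)) with 1 by (simpl; field).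
now apply Rpower_1.
Qed.

Lemma Rpower_two_thirds (x : R) : Rpower x (2 / 3) = Rpower x (1 / 3) ^ 2.
Proof.
rewrite <- Rpower_INR_mult; f_equal; simpl; field.
Qed.

(** With [k] the cube root of [3/4], the two terms of the constant are
    [1 / k = (4/3) k^2] and [(2/3) k^2]. *)
Lemma optimal_cost_constant_eq :
  optimal_cost_constant = 2 * Rpower (3 / 4) (1 / 3) ^ 2.
Proof.
unfold optimal_cost_constant; rewrite Rpower_two_thirds.
replace (Rpower (4 / 3) (1 / 3)) with (/ Rpower (3 / 4) (1 / 3)).
- assert (K3 := Rpower_third_pow3 (3 / 4) ltac:(lra)).
  assert (Hk : 0 < Rpower (3 / 4) (1 / 3)) by apply exp_pos.
  set (k := Rpower (3 / 4) (1 / 3)) in *.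
  replace (/ k) with (4 / 3 * k ^ 2); [field |].
  apply Rmult_eq_reg_r with k; [| lra].
  rewrite Rinv_l by lra.
  replace (4 / 3 * k ^ 2 * k) with (4 / 3 * k ^ 3) by ring.
  rewrite K3; field.
- unfold Rpower; rewrite <- exp_Ropp; f_equal.
  replace (4 / 3) with (/ (3 / 4)) by field.
  rewrite ln_Rinv by lra; ring.
Qed.

Lemma optimal_cost_constant_bounds :
  Rabs (optimal_cost_constant - 1651 / 1000) < 5 / 10000.
Proof.
rewrite optimal_cost_constant_eq.
assert (K3 := Rpower_third_pow3 (3 / 4) ltac:(lra)).
assert (Hk : 0 < Rpower (3 / 4) (1 / 3)) by apply exp_pos.
set (k := Rpower (3 / 4) (1 / 3)) in *.
(* [0.9085^3 < 0.7499] and [0.7503 < 0.9087^3]. *)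
assert (Hlo : 9085 / 10000 < k).
{ apply Rnot_le_lt; intros H.
  assert (k ^ 3 <= (9085 / 10000) ^ 3) by (apply pow_incr; lra); lra. }
assert (Hhi : k < 9087 / 10000).
{ apply Rnot_le_lt; intros H.
  assert ((9087 / 10000) ^ 3 <= k ^ 3) by (apply pow_incr; lra); lra. }
apply Rabs_def1; nra.
Qed.

(** * Asymptotics of the minimizer and of its cost *)

Lemma is_lim_seq_Rpower_third :
  is_lim_seq (fun n => Rpower (INR n) (1 / 3)) p_infty.
Proof.
apply (is_lim_comp_seq exp (fun n => 1 / 3 * ln (INR n)) p_infty p_infty).
- apply is_lim_exp_p.
- now exists 0%nat.
- replace p_infty with (Rbar_mult (1 / 3) p_infty) at 1.
  + apply is_lim_seq_scal_l.
    apply (is_lim_comp_seq ln INR p_infty p_infty).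
    * apply is_lim_ln_p.
    * now exists 0%nat.
    * apply is_lim_seq_INR.
  + apply is_Rbar_mult_unique, is_Rbar_mult_sym, is_Rbar_mult_p_infty_pos.
    simpl; lra.
Qed.

(** As [r = p / a] solves [r^3 + (3/4) r^2 / a = 1], it is at most [1], and
    then [1 - r <= 1 - r^3 <= 3 / (4 a)]. *)
Lemma critical_ratio_bounds (a p : R) :
  0 < a -> 0 < p -> 4 * p ^ 3 + 3 * p ^ 2 = 4 * a ^ 3 ->
  1 - 3 / 4 * / a <= p / a <= 1.
Proof.
intros Ha Hp E.
assert (Hr : 0 < p / a) by now apply Rdiv_lt_0_compat.
assert (Hi : 0 < / a) by now apply Rinv_0_lt_compat.
assert (Er : (p / a) ^ 3 + 3 / 4 * (p / a) ^ 2 * / a = 1).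
{ replace ((p / a) ^ 3 + 3 / 4 * (p / a) ^ 2 * / a)
    with ((4 * p ^ 3 + 3 * p ^ 2) / (4 * a ^ 3)) by (field; lra).
  rewrite E; field; lra. }
set (r := p / a) in *; set (b := / a) in *.
assert (Hr1 : r <= 1).
{ apply Rnot_lt_le; intros H.
  assert (1 < r ^ 3) by (apply Rlt_pow_R1; [assumption | lia]).
  assert (0 < r ^ 2 * b) by (apply Rmult_lt_0_compat; [nra | assumption]).
  lra. }
assert (r ^ 2 <= 1) by nra.
assert (r ^ 3 <= r) by nra.
assert (r ^ 2 * b <= 1 * b) by (apply Rmult_le_compat_r; lra).
split; lra.
Qed.

Lemma is_lim_seq_critical_ratio (a p : nat -> R) :
  is_lim_seq (fun n => / a n) 0 ->
  eventually (fun n => 0 < a n /\ 0 < p n /\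
                       4 * p n ^ 3 + 3 * p n ^ 2 = 4 * a n ^ 3) ->
  is_lim_seq (fun n => p n / a n) 1.
Proof.
intros La Hev.
apply (is_lim_seq_le_le_loc (fun n => 1 - 3 / 4 * / a n) _ (fun _ => 1)).
- revert Hev; apply filter_imp; intros n [Ha [Hp E]].
  now apply critical_ratio_bounds.
- replace (Finite 1) with (Finite (1 - 3 / 4 * 0)) by (f_equal; ring).
  apply is_lim_seq_minus'; [apply is_lim_seq_const |].
  apply (is_lim_seq_scal_l _ (3 / 4) 0 La).
- apply is_lim_seq_const.
Qed.

(** The form of the cost ratio in which each term has an evident limit; the
    hypothesis turns [n^3 / p] into a multiple of [n a^3 / p]. *)
Lemma mult_count_ratio (n : nat) (a p : R) :
  0 < INR n -> 0 < a -> 0 < p -> 3 * INR n ^ 2 = 4 * a ^ 3 ->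
  mult_count n p / (2 * INR n * a ^ 2) =
  2 / 3 * / (p / a) + 3 * (INR n / a ^ 2)
  + 1 / 3 * ((p / a) * (p / a)) + 1 / 2 * ((p / a) * / a)
  + 1 / 6 * (/ a * / a).
Proof.
intros Hn Ha Hp E; unfold mult_count.
replace (INR n ^ 3) with (INR n * (4 / 3 * a ^ 3)).
- field; lra.
- replace (INR n ^ 3) with (INR n * INR n ^ 2) by ring.
  f_equal; lra.
Qed.

Lemma is_lim_seq_mult_count_ratio (a p : nat -> R) :
  is_lim_seq (fun n => / a n) 0 ->
  is_lim_seq (fun n => INR n / a n ^ 2) 0 ->
  is_lim_seq (fun n => p n / a n) 1 ->
  eventually (fun n => 0 < INR n /\ 0 < a n /\ 0 < p n /\
                       3 * INR n ^ 2 = 4 * a n ^ 3) ->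
  is_lim_seq (fun n => mult_count n (p n) / (2 * INR n * a n ^ 2)) 1.
Proof.
intros La Lna Lr Hev.
apply (is_lim_seq_ext_loc (fun n =>
  2 / 3 * / (p n / a n) + 3 * (INR n / a n ^ 2)
  + 1 / 3 * ((p n / a n) * (p n / a n)) + 1 / 2 * ((p n / a n) * / a n)
  + 1 / 6 * (/ a n * / a n))).
{ revert Hev; apply filter_imp; intros n [Hn [Ha [Hp E]]]; symmetry.
  now apply mult_count_ratio. }
assert (Li : is_lim_seq (fun n => / (p n / a n)) (/ 1)).
{ apply (is_lim_seq_inv _ 1 Lr); intros H; injection H; lra. }
replace (Finite 1) with
  (Finite (2 / 3 * / 1 + 3 * 0 + 1 / 3 * (1 * 1) + 1 / 2 * (1 * 0)
           + 1 / 6 * (0 * 0))) by (f_equal; field).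
repeat apply is_lim_seq_plus';
  (apply is_lim_seq_mult'; [apply is_lim_seq_const |]);
  try assumption; now apply is_lim_seq_mult'.
Qed.

(** The first-order prediction [a] for the minimizer, characterized by
    [4 a^3 = 3 n^2]: the quadratic term of the cubic is dropped. *)
Definition predicted_processors (n : nat) : R :=
  Rpower (3 / 4) (1 / 3) * Rpower (INR n) (2 / 3).

Lemma predicted_processors_pos (n : nat) : 0 < predicted_processors n.
Proof. apply Rmult_lt_0_compat; apply exp_pos. Qed.

Lemma predicted_processors_cubic (n : nat) :
  (1 <= n)%nat -> 3 * INR n ^ 2 = 4 * predicted_processors n ^ 3.
Proof.
intros Hn; unfold predicted_processors; rewrite Rpower_two_thirds.
rewrite Rpow_mult_distr, Rpower_third_pow3 by lra.
rewrite <- pow_mult, Nat.mul_comm, pow_mult, Rpower_third_pow3.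
- field.
- apply lt_0_INR; lia.
Qed.

Lemma is_lim_seq_inv_Rpower_third :
  is_lim_seq (fun n => / Rpower (INR n) (1 / 3)) 0.
Proof.
now apply (is_lim_seq_inv _ p_infty is_lim_seq_Rpower_third).
Qed.

Lemma is_lim_seq_inv_predicted_processors :
  is_lim_seq (fun n => / predicted_processors n) 0.
Proof.
assert (Hk : 0 < Rpower (3 / 4) (1 / 3)) by apply exp_pos.
apply (is_lim_seq_ext (fun n => / Rpower (3 / 4) (1 / 3) *
  (/ Rpower (INR n) (1 / 3) * / Rpower (INR n) (1 / 3)))).
- intros n; unfold predicted_processors; rewrite Rpower_two_thirds.
  assert (0 < Rpower (INR n) (1 / 3)) by apply exp_pos.
  field; lra.
- replace (Finite 0) with (Finite (/ Rpower (3 / 4) (1 / 3) * (0 * 0)))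
    by (f_equal; ring).
  apply is_lim_seq_mult'; [apply is_lim_seq_const |].
  apply is_lim_seq_mult'; apply is_lim_seq_inv_Rpower_third.
Qed.

(** This kills the term [6 n^2] of the cost: [a^2] has order [n^(4/3)], so the
    quotient is [1 / (k^2 t)] with [t = n^(1/3)]. *)
Lemma is_lim_seq_INR_div_predicted_sqr :
  is_lim_seq (fun n => INR n / predicted_processors n ^ 2) 0.
Proof.
assert (Hk : 0 < Rpower (3 / 4) (1 / 3)) by apply exp_pos.
apply (is_lim_seq_ext_loc (fun n => / Rpower (3 / 4) (1 / 3) ^ 2 *
  / Rpower (INR n) (1 / 3))).
- exists 1%nat; intros n Hn.
  unfold predicted_processors; rewrite Rpower_two_thirds.
  assert (Hn0 : 0 < INR n) by (apply lt_0_INR; lia).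
  assert (T3 := Rpower_third_pow3 (INR n) Hn0).
  assert (0 < Rpower (INR n) (1 / 3)) by apply exp_pos.
  set (t := Rpower (INR n) (1 / 3)) in *.
  rewrite <- T3; field; lra.
- replace (Finite 0) with (Finite (/ Rpower (3 / 4) (1 / 3) ^ 2 * 0))
    by (f_equal; ring).
  apply is_lim_seq_mult'; [apply is_lim_seq_const |].
  apply is_lim_seq_inv_Rpower_third.
Qed.

(** [C n^(7/3)] is [2 n a^2], because [C = 2 k^2] and
    [a^2 = k^2 n^(4/3)]. *)
Lemma predicted_cost_eq (n : nat) :
  (1 <= n)%nat ->
  optimal_cost_constant * Rpower (INR n) (2 + 1 / 3) =
  2 * INR n * predicted_processors n ^ 2.
Proof.
intros Hn; unfold predicted_processors.
rewrite optimal_cost_constant_eq, Rpower_two_thirds.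
replace (2 + 1 / 3) with (INR 7 * (1 / 3)) by (simpl; field).
rewrite Rpower_INR_mult.
assert (T3 := Rpower_third_pow3 (INR n) ltac:(apply lt_0_INR; lia)).
set (t := Rpower (INR n) (1 / 3)) in *.
rewrite <- T3; ring.
Qed.

Theorem corollary7 :
  (forall n : nat, (1 <= n)%nat -> exists! p : R, optimal_processors n p) /\
  (forall pstar : nat -> R,
     (forall n : nat, (1 <= n)%nat -> optimal_processors n (pstar n)) ->
     asymp_equiv pstar
       (fun n => Rpower (3 / 4) (1 / 3) * Rpower (INR n) (2 / 3)) /\
     asymp_equiv (fun n => mult_count n (pstar n))
       (fun n => optimal_cost_constant * Rpower (INR n) (2 + 1 / 3))) /\
  Rabs (optimal_cost_constant - 1651 / 1000) < 5 / 10000.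
Proof.
split; [exact optimal_processors_unique |].
split; [| exact optimal_cost_constant_bounds].
intros pstar Hopt.
assert (Hcrit : forall n, (1 <= n)%nat ->
  0 < pstar n /\ 4 * pstar n ^ 3 + 3 * pstar n ^ 2 = 3 * INR n ^ 2)
  by (intros n Hn; apply optimal_processors_iff; auto).
assert (Lr : is_lim_seq (fun n => pstar n / predicted_processors n) 1).
{ apply is_lim_seq_critical_ratio; [exact is_lim_seq_inv_predicted_processors |].
  exists 1%nat; intros n Hn; destruct (Hcrit n Hn) as [Hp E].
  rewrite <- (predicted_processors_cubic n Hn).
  auto using predicted_processors_pos. }
split; [exact Lr |].
unfold asymp_equiv.
apply (is_lim_seq_ext_loc (fun n =>
  mult_count n (pstar n) / (2 * INR n * predicted_processors n ^ 2))).
- exists 1%nat; intros n Hn; now rewrite predicted_cost_eq.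
- apply is_lim_seq_mult_count_ratio;
    [exact is_lim_seq_inv_predicted_processors
    | exact is_lim_seq_INR_div_predicted_sqr | exact Lr |].
  exists 1%nat; intros n Hn; destruct (Hcrit n Hn) as [Hp _].
  assert (0 < INR n) by (apply lt_0_INR; lia).
  auto using predicted_processors_pos, predicted_processors_cubic.
Qed.
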